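(* Let $f:\mathbb{R}^n\to\mathbb{R}$ be continuously differentiable with a minimizer $x_*$. Suppose that $\nabla f$ is Lipschitz continuous with constant $L>0$ and that $f$ is strongly convex with parameter $\mu>0$. Let $\rho$ be a constant with $0<\rho\le\mu/L$. Let $x_0\in\mathbb{R}^n$ be a fixed (deterministic) point, let $(e_k)_{k\ge 0}$ be a sequence of $\mathbb{R}^n$-valued random vectors on a common probability space (not assumed to have zero mean or to be independent), and define $x_{k+1}=x_k-\frac1L\big(\nabla f(x_k)+e_k\big)$ for $k\ge0$. Suppose that there are (deterministic) real sequences $(\pi_k)_{k\ge0}$ and $(B_k)_{k\ge0}$ such that for all $k\ge 0$ $$0\le \pi_k\le \mathbb{E}[f(x_k)-f(x_* )],\qquad 0\le B_k\le 2L(\mu/L-\rho)\,\pi_k,\qquad \mathbb{E}[\|e_k\|^2]\le B_k .$$ Then for all $k\ge0$, $$\mathbb{E}[f(x_{k+1})-f(x_* )]\le(1-\rho)\,\mathbb{E}[f(x_k)-f(x_* )].$$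
   Context: $\|\cdot\|$ is the Euclidean norm on $\mathbb{R}^n$ and $\mathbb{E}$ denotes expectation. Lipschitz continuity of the gradient with constant $L$ means $\|\nabla f(x)-\nabla f(y)\|\le L\|x-y\|$ for all $x,y\in\mathbb{R}^n$. Strong convexity with parameter $\mu$ means $f(y)\ge f(x)+(y-x)^T\nabla f(x)+\frac{\mu}{2}\|y-x\|^2$ for all $x,y\in\mathbb{R}^n$. *)

(* Defs.v *)
From HB Require Import structures.
From mathcomp Require Import all_boot all_order all_algebra.
From mathcomp Require Import all_classical all_reals all_analysis.

Set Implicit Arguments.
Unset Strict Implicit.
Unset Printing Implicit Defensive.

Import Order.TTheory GRing.Theory Num.Theory.
Import numFieldNormedType.Exports.

Local Open Scope classical_set_scope.
Local Open Scope ring_scope.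

Section Euclidean.
Context {R : realType} {n : nat}.
Implicit Types (u v x y : 'rV[R]_n) (f : 'rV[R]_n -> R).

Definition dot u v : R := \sum_(i < n) u ord0 i * v ord0 i.

(* The library norm `|v| on 'rV[R]_n is the sup norm; it induces the same
   topology (hence the same notions of continuity, differentiability and
   Borel sets) as the Euclidean norm, but quantitative bounds differ. *)
Definition enorm v : R := Num.sqrt (dot v v).

(* Vector of partial derivatives; it represents the differential 'd f x only
   where f is differentiable. *)
Definition gradient f x : 'rV[R]_n := \row_(i < n) 'D_(delta_mx ord0 i) f x.

Definition continuously_differentiable f : Prop :=
  (forall x, differentiable f x) /\ continuous (gradient f).

Definition lipschitz_gradient f (L : R) : Prop :=
  forall x y, enorm (gradient f x - gradient f y) <= L * enorm (x - y).

Definition strongly_convex f (mu : R) : Prop :=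
  forall x y,
    f y >= f x + dot (y - x) (gradient f x) + mu / 2 * enorm (y - x) ^+ 2.

Definition minimizer f x : Prop := forall y, f x <= f y.

End Euclidean.

(* R^n equipped with its Borel sigma-algebra, so that
   {RV P >-> borel_rV R n} is the type of R^n-valued random vectors. *)
Notation borel_rV R n := (g_sigma_algebraType (@open 'rV[R]_n)).

(* Main.v *)
(* With step 1/L the descent lemma
   f y <= f x + <y - x, grad f x> + L/2 |y - x|^2 gives, the cross terms in e
   cancelling,
     f (x_{k+1}) <= f (x_k) - |grad f (x_k)|^2 / (2 L) + |e_k|^2 / (2 L),
   and strong convexity gives the Polyak-Lojasiewicz inequality
   2 mu (f x - f xstar) <= |grad f x|^2.  Hence the gap contracts pointwise by
   1 - mu/L up to the error |e_k|^2 / (2 L), whose expectation is at most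
   B_k / (2 L) <= (mu/L - rho) pi_k <= (mu/L - rho) E[f (x_k) - f xstar].
   As 0 <= 1 - mu/L and 0 <= mu/L - rho, all integrals are of nonnegative
   functions and no integrability is needed. *)
Require Import Defs.
From HB Require Import structures.
From mathcomp Require Import all_boot all_order all_algebra.
From mathcomp Require Import all_classical all_reals all_analysis.
From mathcomp Require Import measurable_realfun ring lra.
Import Order.TTheory GRing.Theory Num.Theory.
Import numFieldNormedType.Exports.
Local Open Scope classical_set_scope.
Local Open Scope ring_scope.

(** * Measurability of maps into and out of the space of row vectors *)

(** An open set is the union of the boxes it contains that have a rational centre and radius
    [1/(m+1)]. There are countably many, and the preimage of each is a finite intersection of
    coordinate preimages. *)
Lemma measurable_preimage_open_rV (R : realType) (n : nat)
    (d : measure_display) (T : measurableType d) (h : T -> 'rV[R]_n)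
    (U : set 'rV[R]_n) :
  (forall i, measurable_fun setT (fun w => h w ord0 i)) ->
  open U -> measurable (h @^-1` U).
Proof.
move=> mh oU.
pose box (c : 'rV[rat]_n * nat) : set 'rV[R]_n :=
  \bigcap_(i in [set: 'I_n])
    [set v : 'rV[R]_n |
      ball (ratr (c.1 ord0 i) : R) (c.2.+1%:R^-1) (v ord0 i)].
pose box_in c : Prop := box c `<=` U.
(* Boxes not inside [U] contribute [set0], so the union ranges over a whole countable type. *)
have -> : h @^-1` U =
    \bigcup_c (if `[< box_in c >] then h @^-1` box c else set0).
  apply/seteqP; split=> [w /= Uhw|w [c _]]; last first.
    by case: ifPn => // /asboolP cU /cU.
  have /nbhs_ballP[r /= r0 rU] : nbhs (h w) U by exact: open_nbhs_nbhs.
  (* Two points of a box are each within [1/(m+1)] of its centre in every coordinate, so half of [r]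
     keeps a box around [h w] inside the [r]-ball. *)
  have [m /ltW mr] : exists m : nat, m.+1%:R^-1 < r / 2.
    have r2 : 0 < r / 2 by rewrite divr_gt0.
    have [m _ /(_ _ (leqnn m)) mr] := near_infty_natSinv_lt (PosNum r2).
    by exists m.
  have mp : 0 < m.+1%:R^-1 :> R by rewrite invr_gt0.
  have /choice[q qP] (i : 'I_n) : exists q : rat,
      ratr q \in
        `](h w ord0 i - m.+1%:R^-1), (h w ord0 i + m.+1%:R^-1)[.
    by apply: rat_in_itvoo; rewrite ltrBlDr -addrA ltrDl addr_gt0.
  exists (\row_i q i, m) => //.
  have wbox : box (\row_i q i, m) (h w).
    move=> i _ /=; rewrite mxE; apply: ball_sym.
    by have := qP i; rewrite in_itv /= -ltr_distlC.
  case: ifPn => [_ //|/asboolP]; case => v vbox; apply: rU.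
  split => // i j; rewrite (ord1 i).
  apply: le_ball; last first.
    apply: ball_triangle; last exact: (vbox j I).
    apply: ball_sym; exact: (wbox j I).
  by rewrite /= [leRHS]splitr lerD.
apply: countable_bigcupT_measurable => // c.
case: ifPn => // _; rewrite /box preimage_bigcap.
apply: fin_bigcap_measurable => // i _.
rewrite -[X in measurable X]setTI.
apply: (mh i) => //.
apply: open_measurable; exact: ball_open.
Qed.

Lemma measurable_continuous_comp_rV (R : realType) (n : nat)
    (d : measure_display) (T : measurableType d) (h : T -> 'rV[R]_n)
    (g : 'rV[R]_n -> R) :
  (forall i, measurable_fun setT (fun w => h w ord0 i)) ->
  continuous g -> measurable_fun setT (fun w => g (h w)).
Proof.
move=> mh cg.
apply: (@measurability _ _ _ _ _ (fun w => g (h w)) _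
  (RGenOInfty.measurableE R)) => //.
move=> _ [_ [a ->] <-]; rewrite setTI.
have oU : open (g @^-1` `]a, +oo[).
  by apply: open_comp => [v _|]; [exact: cg | exact: interval_open].
exact: (measurable_preimage_open_rV _ _ _ _ h _ mh oU).
Qed.

Lemma measurable_coord_borel_rV (R : realType) (n : nat)
    (d : measure_display) (T : measurableType d) (h : T -> borel_rV R n) i :
  measurable_fun setT h ->
  measurable_fun setT (fun w => (h w : 'rV[R]_n) ord0 i).
Proof.
move=> mh.
apply: (@measurability _ _ _ _ _ (fun w => (h w : 'rV[R]_n) ord0 i) _
  (RGenOInfty.measurableE R)) => //.
move=> _ [_ [a ->] <-].
have oU : open ((fun v : 'rV[R]_n => v ord0 i) @^-1` `]a, +oo[).
  by apply: open_comp => [v _|];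
    [exact: coord_continuous | exact: interval_open].
have mU : measurable ((fun v : 'rV[R]_n => v ord0 i) @^-1` `]a, +oo[ :
    set (borel_rV R n)).
  exact: sub_sigma_algebra.
exact: (mh measurableT _ mU).
Qed.

(** * Algebra of the Euclidean inner product *)

Section Dot.
Context {R : realType} {n : nat}.
Implicit Types u v w : 'rV[R]_n.

Lemma dotC u v : dot u v = dot v u.
Proof. by apply: eq_bigr => i _; rewrite mulrC. Qed.

Lemma dotDl u v w : dot (u + v) w = dot u w + dot v w.
Proof. by rewrite -big_split /=; apply: eq_bigr => i _; rewrite mxE mulrDl. Qed.

Lemma dotZl a u v : dot (a *: u) v = a * dot u v.
Proof. by rewrite [RHS]mulr_sumr; apply: eq_bigr => i _; rewrite mxE mulrA. Qed.

Lemma dotNl u v : dot (- u) v = - dot u v.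
Proof. by rewrite -scaleN1r dotZl mulN1r. Qed.

Lemma dotDr u v w : dot u (v + w) = dot u v + dot u w.
Proof. by rewrite !(dotC u) dotDl. Qed.

Lemma dotZr a u v : dot u (a *: v) = a * dot u v.
Proof. by rewrite !(dotC u) dotZl. Qed.

Lemma dotNr u v : dot u (- v) = - dot u v.
Proof. by rewrite !(dotC u) dotNl. Qed.

Lemma dot_ge0 u : 0 <= dot u u.
Proof. by apply: sumr_ge0 => i _; rewrite -expr2 sqr_ge0. Qed.

Lemma dot_eq0 u : dot u u = 0 -> u = 0.
Proof.
move=> /eqP; rewrite psumr_eq0 => [|i _]; last by rewrite -expr2 sqr_ge0.
move=> /allP u0; apply/rowP => i; rewrite mxE; apply/eqP.
by have := u0 i (mem_index_enum i); rewrite /= -expr2 sqrf_eq0.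
Qed.

Lemma sqr_enorm u : enorm u ^+ 2 = dot u u.
Proof. by rewrite sqr_sqrtr // dot_ge0. Qed.

End Dot.

(** * Deterministic inequalities from smoothness and strong convexity *)

Section Descent.
Context {R : realType} {n : nat}.
Variables (f : 'rV[R]_n -> R) (L mu : R).
Implicit Types x y v : 'rV[R]_n.

Lemma derive_dot_gradient x v :
  differentiable f x -> 'D_v f x = dot v (gradient f x).
Proof.
move=> df; rewrite deriveE // {1}(row_sum_delta v) linear_sum /=.
by apply: eq_bigr => i _; rewrite linearZ /= mxE deriveE.
Qed.

Lemma is_derive_line x v (t : R) : differentiable f (x + t *: v) ->
  is_derive t (1 : R) (fun s : R => f (x + s *: v))
    (dot v (gradient f (x + t *: v))).
Proof.
move=> df.
(* The difference quotients along the line and at [x + t *: v] coincide, so no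
   chain rule is needed. *)
have quotientE :
    (fun h : R =>
      h^-1 *: (f (x + (h *: (1 : R) + t) *: v) - f (x + t *: v))) =
    (fun h : R => h^-1 *: (f (h *: v + (x + t *: v)) - f (x + t *: v))).
  by apply/funext => h; rewrite [h *: 1]mulr1 scalerDl addrCA.
have dv : derivable f (x + t *: v) v by exact: diff_derivable.
split.
  by move: dv; rewrite /derivable /= -quotientE.
by rewrite -derive_dot_gradient // /derive /= -quotientE.
Qed.

Hypothesis df : forall x, differentiable f x.
Hypothesis L_gt0 : 0 < L.
Hypothesis f_lip : lipschitz_gradient f L.

(** The mean value theorem on [0, 1] is applied to [phi], the restriction of [f] to the segment
    minus its linear part and the quadratic bound: [phi 1 - phi 0] is [dphi c], which the Lipschitz
    bound makes nonpositive. *)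
Lemma descent_lemma x y :
  f y <= f x + dot (y - x) (gradient f x) + L / 2 * dot (y - x) (y - x).
Proof.
have: x + (y - x) = y by rewrite addrC subrK.
move: (y - x) => v xv; set g := gradient f x.
pose phi (s : R) :=
  f (x + s *: v) - (s * dot v g + s ^+ 2 * (L / 2 * dot v v)).
pose dphi (s : R) :=
  dot v (gradient f (x + s *: v)) - (dot v g + (2 * s) * (L / 2 * dot v v)).
have phi' (s : R) : is_derive s (1 : R) phi (dphi s).
  have fl := is_derive_line _ _ _ (df (x + s *: v)).
  (* Written as a combination of functions, [phi] has a derivative that instance inference can
     compute. *)
  have -> : phi = (fun r : R => f (x + r *: v)) -
      (dot v g *: id + (L / 2 * dot v v) *: (id ^+ 2)).
    apply/funext => r.
    by rewrite /phi !fctE /= [dot v g *: r]mulrC [_ *: (r ^+ 2)]mulrC.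
  apply: is_derive_eq.
  rewrite /dphi /= expr1; congr (_ - (_ + _));
    by rewrite ?scaler1 /GRing.scale /= ?mulr1 // mulrC.
have cphi : continuous phi.
  move=> s; apply/differentiable_continuous/derivable1_diffP.
  exact: ex_derive.
have [c cI] := MVT (ltr01 : (0 : R) < 1) (fun s _ => phi' s)
  (continuous_subspaceT cphi).
move: cI; rewrite in_itv /= => /andP[c0 c1].
rewrite subr0 mulr1 /phi scale1r scale0r addr0 xv => E.
suff : dphi c <= 0 by move: E; rewrite -/g; lra.
have := f_lip (x + c *: v) x.
set G := gradient f (x + c *: v); rewrite addrAC subrr add0r => lipG.
have sqG : dot (G - g) (G - g) <= (L * c) ^+ 2 * dot v v.
  have : enorm (G - g) ^+ 2 <= (L * enorm (c *: v)) ^+ 2.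
    by rewrite ler_sqr ?nnegrE // ?mulr_ge0 ?sqrtr_ge0 // ltW.
  by rewrite exprMn !sqr_enorm dotZl dotZr !exprMn; lra.
(* Expanding this square bounds [2 L c <v, G - g>] by [2 (L c |v|)^2]. *)
have := dot_ge0 (G - g - (L * c) *: v).
move: sqG; rewrite /dphi -/G.
rewrite !(dotDl, dotDr, dotNl, dotNr, dotZl, dotZr).
rewrite (dotC g G) (dotC G v) (dotC g v).
have Lc : 0 < L * c by rewrite mulr_gt0.
move=> sqG sq_ge0.
(* The second factor is [dphi c]; multiplying by [L * c > 0] matches the expanded square. *)
suff : L * c * (dot v G - dot v g - L * c * dot v v) <= 0.
  by rewrite pmulr_rle0 //; lra.
by move: sqG sq_ge0; nra.
Qed.

Lemma gradient_step_le x e :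
  f (x - L^-1 *: (gradient f x + e)) <=
  f x - (2 * L)^-1 * dot (gradient f x) (gradient f x) + (2 * L)^-1 * dot e e.
Proof.
apply: (le_trans (descent_lemma x _)).
rewrite [x - _]addrC addrK !(dotDl, dotDr, dotNl, dotNr, dotZl, dotZr) (dotC e).
set a := dot _ _; set b := dot _ _; set c := dot _ _.
(* For step [1/L] the descent bound equals the right-hand side exactly. *)
rewrite le_eqVlt; apply/orP; left; apply/eqP; field; exact: lt0r_neq0.
Qed.

Hypothesis mu_gt0 : 0 < mu.
Hypothesis f_cvx : strongly_convex f mu.

(** The strong convexity lower bound, as a quadratic in [y - x], is smallest at
    [- gradient f x / mu]; completing the square there gives the estimate. *)
Lemma polyak_lojasiewicz x y :
  2 * mu * (f x - f y) <= dot (gradient f x) (gradient f x).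
Proof.
have := f_cvx x y; rewrite sqr_enorm => cvx.
have := dot_ge0 (gradient f x + mu *: (y - x)).
move: cvx; move: (y - x) => v cvx.
rewrite !(dotDl, dotDr, dotZl, dotZr) (dotC (gradient f x) v).
have := ler_wpM2l (ltW mu_gt0) cvx; lra.
Qed.

(** The quadratic lower and upper bounds at [y] share their linear part, so [mu] and [L] can be
    compared once [y - x] is nonzero, which [f x < f y] ensures. *)
Lemma strong_convexity_le_lipschitz x y : f x < f y -> mu <= L.
Proof.
move=> fxy; rewrite leNgt; apply/negP => Lmu.
have := f_cvx x y; have := descent_lemma x y; rewrite sqr_enorm.
have := dot_ge0 (y - x).
rewrite le_eqVlt => /orP[/eqP/esym/dot_eq0/eqP|]; last by nra.
by rewrite subr_eq0 => /eqP yx; move: fxy; rewrite yx ltxx.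
Qed.

Lemma inexact_gradient_step_gap x e y :
  f (x - L^-1 *: (gradient f x + e)) - f y <=
  (1 - mu / L) * (f x - f y) + (2 * L)^-1 * enorm e ^+ 2.
Proof.
have := gradient_step_le x e; have := polyak_lojasiewicz x y; rewrite sqr_enorm.
set G := dot (gradient f x) _ => pl step.
have : mu / L * (f x - f y) <= (2 * L)^-1 * G.
  have -> : mu / L * (f x - f y) = (2 * L)^-1 * (2 * mu * (f x - f y)).
    by field; exact: lt0r_neq0.
  by rewrite ler_wpM2l // invr_ge0 mulr_ge0 // ltW.
lra.
Qed.

End Descent.

(** * Measurability of the iterates *)

(** Induction on [k], stated by coordinates so that each step is arithmetic of real-valued
    measurable functions; continuity of the gradient carries measurability through [gradient f]. *)
Lemma measurable_inexact_gradient_iterates (R : realType) (n : nat)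
    (d : measure_display) (T : measurableType d)
    (f : 'rV[R]_n -> R) (L : R) (x0 : 'rV[R]_n)
    (e : nat -> T -> borel_rV R n) (x : nat -> T -> 'rV[R]_n) :
  continuous (gradient f) ->
  (forall k, measurable_fun setT (e k)) ->
  (forall w, x 0%N w = x0) ->
  (forall k w, x k.+1 w = x k w - L^-1 *: (gradient f (x k w) + e k w)) ->
  forall k i, measurable_fun setT (fun w => x k w ord0 i).
Proof.
move=> cg me x_init x_step; elim=> [|k IH] i.
  by under eq_fun do rewrite x_init; exact: measurable_cst.
have stepE : (fun w => x k.+1 w ord0 i) = (fun w => x k w ord0 i) \-
    (fun w => L^-1 * (gradient f (x k w) ord0 i + (e k w : 'rV[R]_n) ord0 i)).
  by apply/funext => w; rewrite /= x_step !mxE.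
rewrite stepE; apply: measurable_funB; first exact: IH.
apply: measurable_funM; first exact: measurable_cst.
apply: measurable_funD; last exact: measurable_coord_borel_rV.
apply: (measurable_continuous_comp_rV _ _ _ _ _
  (fun v => gradient f v ord0 i)) => // v.
apply: (@continuous_comp _ _ _ (gradient f) (fun u : 'rV[R]_n => u ord0 i)).
  exact: cg.
exact: coord_continuous.
Qed.

(** * Contraction of the expected gap *)

Theorem theorem2p5 (R : realType) (n : nat)
    (d : measure_display) (T : measurableType d) (P : probability T R)
    (f : 'rV[R]_n -> R) (xstar : 'rV[R]_n) (L mu rho : R)
    (x0 : 'rV[R]_n) (e : nat -> {RV P >-> borel_rV R n})
    (x : nat -> T -> 'rV[R]_n) (pi_ B : nat -> R)
    (f_C1 : continuously_differentiable f)
    (xstar_min : minimizer f xstar)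
    (L_gt0 : 0 < L) (f_lip : lipschitz_gradient f L)
    (mu_gt0 : 0 < mu) (f_cvx : strongly_convex f mu)
    (rho_gt0 : 0 < rho) (rho_le : rho <= mu / L)
    (x_init : forall w : T, x 0%N w = x0)
    (x_step : forall (k : nat) (w : T),
       x k.+1 w = x k w - L^-1 *: (gradient f (x k w) + e k w))
    (pi_ge0 : forall k : nat, 0 <= pi_ k)
    (pi_le : forall k : nat,
       ((pi_ k)%:E <= 'E_P[fun w => (f (x k w) - f xstar)%R])%E)
    (B_ge0 : forall k : nat, 0 <= B k)
    (B_le : forall k : nat, B k <= 2 * L * (mu / L - rho) * pi_ k)
    (e_le : forall k : nat, ('E_P[fun w => (enorm (e k w) ^+ 2)%R] <= (B k)%:E)%E) :
  forall k : nat,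
    ('E_P[fun w => (f (x k.+1 w) - f xstar)%R]
       <= (1 - rho)%R%:E * 'E_P[fun w => (f (x k w) - f xstar)%R])%E.
Proof.
move=> k.
have [df cg] := f_C1.
have mf j : measurable_fun setT (fun w => f (x j w) - f xstar).
  apply: measurable_funB; last exact: measurable_cst.
  apply: measurable_continuous_comp_rV; last first.
    by move=> v; exact: differentiable_continuous.
  by apply: (@measurable_inexact_gradient_iterates _ _ _ _ f L x0
    (fun k => e k)).
have f_ge0 j w : 0 <= f (x j w) - f xstar by rewrite subr_ge0.
have me : measurable_fun setT (fun w => enorm (e k w) ^+ 2).
  under eq_fun do rewrite sqr_enorm.
  apply: measurable_sum => i.
  by apply: measurable_funM; exact: measurable_coord_borel_rV.
(* If [f] is constant (which forces [n = 0]), [mu <= L] may fail, but all gaps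
   vanish. *)
have [f_min|/existsNP[y /negP f_nmin]] := pselect (forall y, f y <= f xstar).
  have f0 j : ('E_P[fun w => (f (x j w) - f xstar)%R] = 0)%E.
    rewrite unlock; apply: integral0_eq => w _; congr EFin.
    by apply/eqP; rewrite eq_le f_ge0 andbT subr_le0.
  by rewrite !f0 mule0.
have mu_le_L : mu <= L.
  apply: (strong_convexity_le_lipschitz f L mu df L_gt0 f_lip f_cvx xstar y).
  by rewrite ltNge.
have c0 : 0 <= 1 - mu / L by rewrite subr_ge0 ler_pdivrMr // mul1r.
have i0 : 0 <= (2 * L)^-1 by rewrite invr_ge0 mulr_ge0 // ltW.
have r0 : 0 <= mu / L - rho by rewrite subr_ge0.
set E := ('E_P[fun w => (f (x k w) - f xstar)%R])%E.
set N := ('E_P[fun w => (enorm (e k w) ^+ 2)%R])%E.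
have noise_le : (((2 * L)^-1)%R%:E * N <= (mu / L - rho)%R%:E * E)%E.
  apply: (@le_trans _ _ ((mu / L - rho)%R%:E * (pi_ k)%:E)%E);
    last by rewrite lee_wpmul2l // lee_fin.
  apply: (@le_trans _ _ (((2 * L)^-1)%R%:E * (B k)%:E)%E);
    first by rewrite lee_wpmul2l ?lee_fin //; exact: e_le.
  rewrite -!EFinM lee_fin ler_pdivrMl ?mulr_gt0 // mulrA; exact: B_le.
apply: (@le_trans _ _ ((1 - mu / L)%R%:E * E + ((2 * L)^-1)%R%:E * N)%E);
  last first.
  apply: le_trans (leeD2l _ noise_le) _.
  (* [1 - rho] splits as [(1 - mu / L) + (mu / L - rho)]; as both terms are nonnegative,
     distributivity holds even if [E] is infinite. *)
  by rewrite -ge0_muleDl ?lee_fin // -EFinD addrA subrK.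
(* Merging the right-hand side into one integral reduces the claim to the pointwise gap
   inequality. *)
rewrite /E /N unlock -!ge0_integralZl_EFin //; first last.
- exact/measurable_EFinP.
- by move=> w _; rewrite lee_fin.
- exact/measurable_EFinP.
- by move=> w _; rewrite lee_fin sqr_ge0.
rewrite -ge0_integralD //; first last.
- by apply/measurable_EFinP/measurable_funM => //; exact: measurable_cst.
- by move=> w _; rewrite lee_fin mulr_ge0 // sqr_ge0.
- by apply/measurable_EFinP/measurable_funM => //; exact: measurable_cst.
- by move=> w _; rewrite lee_fin mulr_ge0.
apply: ge0_le_integral => //.
- by move=> w _; rewrite lee_fin.
- exact/measurable_EFinP.
- apply/measurable_EFinP/measurable_funD.
    by apply: measurable_funM => //; exact: measurable_cst.
  by apply: measurable_funM => //; exact: measurable_cst.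
- move=> w _; rewrite -!EFinM -EFinD lee_fin x_step.
  exact: inexact_gradient_step_gap.
Qed.
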